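(* Let $f:M\to N$ be a monoid homomorphism. Then $f^{-1}(1)$ (the preimage of the identity element of $N$) is a normal submonoid of $M$.
   Context: For a monoid $M$ with identity $1$, $U(M)$ denotes its group of units (elements with a two-sided inverse). A groupal submonoid of $M$ is a submonoid $S\subseteq M$ such that $x^{-1}\in S$ for every $x\in S\cap U(M)$. For $A\subseteq M$ and $x,y\in M$, $xAy=\{xay : a\in A\}$. A subset $A\subseteq M$ is invariant if for each $x,y\in M$ the following three conditions are equivalent: (i) $xAy\subseteq A$; (ii) $xy\in A$; (iii) $(xAy)\cap A\neq\emptyset$. A normal submonoid of $M$ is a submonoid which is both groupal and invariant. *)

(* Defs.v *)
From mathcomp Require Import all_boot.
From mathcomp Require Import boolp classical_sets.

Set Implicit Arguments.
Unset Strict Implicit.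
Unset Printing Implicit Defensive.

Local Open Scope classical_set_scope.
Local Open Scope group_scope.

Section NormalSubmonoid.
Variable M : monoidType.
Implicit Types (x y a : M) (A S : set M).

Definition is_inverse x y : Prop := x * y = 1 /\ y * x = 1.

Definition unit_group : set M := [set x | exists y, is_inverse x y].

Definition submonoid S : Prop := monoid_closed [in S].

(* [monoidType] has no inverse operation; the inverse of a unit is unique, so
   quantifying over all inverses [y] of [x] amounts to taking [x^-1]. *)
Definition groupal_submonoid S : Prop :=
  submonoid S /\
  (forall x, (S `&` unit_group) x -> forall y, is_inverse x y -> S y).

Definition translate x A y : set M := [set x * a * y | a in A].

Definition invariant_set A : Prop :=
  forall x y,
    [<-> translate x A y `<=` A;
         A (x * y);
         translate x A y `&` A !=set0].

Definition normal_submonoid S : Prop := groupal_submonoid S /\ invariant_set S.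

End NormalSubmonoid.

(* Main.v *)
Require Import Defs.
From mathcomp Require Import all_boot.
From mathcomp Require Import boolp classical_sets.

Local Open Scope classical_set_scope.
Local Open Scope group_scope.

(** On a translate [x A y] of the preimage [A] of [1], [f] is constant with value [f (x * y)]
    ([fM_ker]), and [x * y] lies in it since [1] is in [A]. So each invariance condition says
    [f (x * y) = 1]. *)

Theorem proposition2p8 (M N : monoidType) (f : UMagmaMorphism.type M N) :
  normal_submonoid (f @^-1` [set 1]).
Proof.
have fM_ker x a y : f a = 1 -> f (x * a * y) = f (x * y).
  by move=> fa1; rewrite !gmulfM fa1 mulg1.
split; [split; [split|]|].
- by apply/mem_set; exact: gmulf1.
- move=> x y /set_mem /= fx1 /set_mem /= fy1.
  by apply/mem_set; rewrite /= gmulfM fx1 fy1 mulg1.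
- move=> x [/= fx1 _] y [xy1 _].
  (* As [f x = 1], [f y = f x * f y = f (x * y) = f 1]. *)
  by rewrite -[f y]mul1g -fx1 -gmulfM xy1 gmulf1.
- move=> x y; tfae => /=.
  + by move=> /(_ (x * 1 * y)); rewrite /= mulg1; apply; exists 1; rewrite ?mulg1 //= gmulf1.
  + by move=> fxy1; exists (x * y); split=> //; exists 1; rewrite ?mulg1 //= gmulf1.
  (* One common point gives [f (x * y) = 1], hence the value on the whole translate. *)
  + move=> [_ [[a /= fa1 <-]]] /=; rewrite fM_ker // => fxy1.
    by move=> _ [b /= fb1 <-] /=; rewrite fM_ker.
Qed.
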